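(* Let $G$ be the modular group, given by the generators $a,b$ and the defining relations $a^2=b^3=1$. Then the commutator subgroup of $G$ is a free group on two generators, with free generators $$\beta_{-1}=b^{-1}aba^{-1},\qquad \beta_0=aba^{-1}b^{-1}.$$ *)

(* Defs.v *)
From HB Require Import structures.
From mathcomp Require Import all_boot.
From mathcomp Require Import classical_sets.

Set Implicit Arguments.
Unset Strict Implicit.
Unset Printing Implicit Defensive.

Local Open Scope classical_set_scope.
Local Open Scope group_scope.

Section FreeGroup.
Variable I : choiceType.

(* The letter (i, false) stands for the generator i, (i, true) for its
   inverse. *)
Local Notation letter := (I * bool)%type.

Implicit Types (l : letter) (u v w : seq letter).

Definition letter_inv l : letter := (l.1, ~~ l.2).

Definition reduced w := sorted (fun l l' => l' != letter_inv l) w.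

Definition push l w :=
  if w is l' :: w' then if l' == letter_inv l then w' else l :: w else [:: l].

Definition reduce w := foldr push [::] w.

Definition word_inv w := rev (map letter_inv w).

Lemma letter_invK : involutive letter_inv.
Proof. by case=> i s; rewrite /letter_inv negbK. Qed.

Lemma push_reduced l w : reduced w -> reduced (push l w).
Proof.
case: w => [|l' w] //= rw; case: eqP => [_|/eqP ne]; first exact: path_sorted rw.
by rewrite /reduced /= ne.
Qed.

Lemma foldr_push_reduced u w : reduced w -> reduced (foldr push w u).
Proof. by move=> rw; elim: u => //= l u; apply: push_reduced. Qed.

Lemma reduce_reduced w : reduced (reduce w).
Proof. exact: foldr_push_reduced. Qed.

Lemma reduce_id w : reduced w -> reduce w = w.
Proof.
elim: w => //= l w IHw rw; rewrite IHw; last exact: path_sorted rw.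
by case: w rw {IHw} => //= l' w /andP[/negPf->].
Qed.

Lemma pushK l w : reduced w -> push l (push (letter_inv l) w) = w.
Proof.
case: w => [|l' w] /=; first by rewrite eqxx.
rewrite letter_invK; case: eqP => [->|_ _] /=; last by rewrite eqxx.
by case: w => //= l'' w /andP[/negPf->].
Qed.

Lemma foldr_push_reduce u w :
  reduced w -> foldr push w (reduce u) = foldr push w u.
Proof.
move=> rw; elim: u => //= l u <-.
case: (reduce u) => //= l' u'; case: eqP => [->|//].
by rewrite pushK // foldr_push_reduced.
Qed.

Lemma word_invK : involutive word_inv.
Proof.
by move=> w; rewrite /word_inv map_rev revK -map_comp map_id_in // => l _ /=;
  exact: letter_invK.
Qed.

Lemma word_inv_reduced w : reduced w -> reduced (word_inv w).
Proof.
rewrite /reduced /word_inv rev_sorted sorted_map; apply: sub_sorted => l l' /=.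
by rewrite letter_invK eq_sym (can2_eq letter_invK letter_invK).
Qed.

Record free_group := FreeGroup {
  fg_word :> seq letter;
  fg_reduced : reduced fg_word
}.
HB.instance Definition _ := [isSub for fg_word].
HB.instance Definition _ := [Choice of free_group by <:].

Implicit Types x y z : free_group.

Definition fg_one : free_group := @FreeGroup [::] isT.
Definition fg_mul x y : free_group :=
  FreeGroup (reduce_reduced (fg_word x ++ fg_word y)).
Definition fg_inv x : free_group := FreeGroup (word_inv_reduced (fg_reduced x)).

Lemma fg_mulE x y : fg_word (fg_mul x y) = foldr push y (fg_word x).
Proof. by rewrite /= /reduce foldr_cat -/(reduce _) reduce_id // fg_reduced. Qed.

Lemma fg_mulA : associative fg_mul.
Proof.
move=> x y z; apply: val_inj.
rewrite [LHS]fg_mulE [RHS]fg_mulE fg_mulE [fg_word (fg_mul x y)]/= foldr_push_reduce ?fg_reduced //.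
by rewrite foldr_cat.
Qed.

Lemma fg_mul1 : left_id fg_one fg_mul.
Proof. by move=> x; apply: val_inj; rewrite /= reduce_id // fg_reduced. Qed.

Lemma fg_mulr1 : right_id fg_one fg_mul.
Proof. by move=> x; apply: val_inj; rewrite /= cats0 reduce_id // fg_reduced. Qed.

Lemma fg_mulV : left_inverse fg_one fg_inv fg_mul.
Proof.
move=> x; apply: val_inj; rewrite [LHS]fg_mulE /=.
elim: (fg_word x) => //= l w IHw.
by rewrite /word_inv /= rev_cons foldr_rcons /= letter_invK eqxx.
Qed.

Lemma fg_mulrV : right_inverse fg_one fg_inv fg_mul.
Proof.
move=> x; rewrite -{1}(_ : fg_inv (fg_inv x) = x) ?fg_mulV //.
by apply: val_inj; apply: word_invK.
Qed.

HB.instance Definition _ :=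
  isGroup.Build free_group fg_mulA fg_mul1 fg_mulr1 fg_mulV fg_mulrV.

Definition fg_gen (i : I) : free_group := @FreeGroup [:: (i, false)] isT.

End FreeGroup.

Section Subgroups.
Variable G : groupType.
Implicit Types (A H N : set G).

Definition subgroup H :=
  [/\ H 1, forall x y, H x -> H y -> H (x * y) & forall x, H x -> H x^-1].

Definition normal_subgroup N :=
  subgroup N /\ forall x y, N x -> N (x ^ y).

Definition generated A : set G := smallest subgroup A.

Definition normal_closure A : set G := smallest normal_subgroup A.

Definition commutator_subgroup : set G :=
  generated [set z | exists x y, z = [~ x, y]].

End Subgroups.

Arguments commutator_subgroup : clear implicits.

(* The relation r = 1 is represented by the element r of the free group, so
   that G = < x | R > means that the kernel of the canonical map from the free
   group onto G is the normal closure of R. *)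
Definition presented_by (G : groupType) (I : choiceType) (x : I -> G)
    (R : set (free_group I)) : Prop :=
  exists f : {multiplicative free_group I -> G},
    [/\ forall i, f (fg_gen i) = x i,
        range f = [set: G]
      & f @^-1` [set 1] = normal_closure R].

Definition freely_generated_by (G : groupType) (H : set G)
    (I : choiceType) (x : I -> G) : Prop :=
  exists f : {multiplicative free_group I -> G},
    [/\ forall i, f (fg_gen i) = x i, injective f & range f = H].

Definition modular_presentation (G : groupType) (a b : G) : Prop :=
  presented_by (tnth [tuple a; b])
    [set fg_gen (ord0 : 'I_2) ^+ 2; fg_gen (ord_max : 'I_2) ^+ 3].

(* Main.v *)
Require Import Defs.
From HB Require Import structures.
From mathcomp Require Import all_boot.
From mathcomp Require Import classical_sets.
From mathcomp Require Import ssralg zmodp finalg.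
From mathcomp Require Import boolp.

(** The abelianization of the modular group G is the group A = Z/2 x Z/3, and
    the elements b^j a^i represent the cosets of the commutator subgroup.
    Moving a generator of G past these representatives gives elements of the
    commutator subgroup: passing a always gives 1, passing b gives 1 if i = 0,
    and if i = 1 it gives
    beta_j = b^j a b a^-1 b^(-j-1), where
    beta_0 beta_1 beta_2 = 1 and beta_2 = beta_{-1} because b^3 = 1.

    The proof makes this rewriting process into a homomorphism. Let F be the
    free group on two letters standing for beta_{-1} and beta_0. In the wreath
    product of F by A, where an element (p, c) moves (w, k) in F x A to
    (w c(k), k + p), the elements (wreath_a, wreath_b) that record the process
    satisfy the relations of G, so they define a homomorphism h from G. Let f
    be the homomorphism from F to G that sends the letters to beta_{-1} and
    beta_0.
    - For w in F, the wreath product element h (f w) has A-component 0 and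
      takes the value w at 0 (subgroup_wreath_retract; only the two letters
      have to be checked), so f is injective.
    - For g in G with h g = (p, c), the element g is f (c 0) times the
      representative of p (subgroup_schreier; only a and b have to be checked).
      If g is in the commutator subgroup then p = 0 because A is abelian, so
      g = f (c 0) is in the range of f.
    - Conversely beta_{-1} = [b, a^-1] and beta_0 = [a^-1, b^-1]. *)

Local Open Scope group_scope.

Set Implicit Arguments.
Unset Strict Implicit.
Unset Printing Implicit Defensive.

(** * Homomorphisms and subgroups *)

Section Homomorphisms.
Context {G H : groupType}.
Implicit Types f : {multiplicative G -> H}.

Lemma multiplicative1 f : f 1 = 1.
Proof. by apply: (@mulgI _ (f 1)); rewrite -gmulfM !mulg1. Qed.

Lemma multiplicativeV f x : f x^-1 = (f x)^-1.
Proof.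
by apply: (@mulgI _ (f x)); rewrite -gmulfM !mulgV multiplicative1.
Qed.

Lemma subgroup_preimage f (S : set H) :
  subgroup S -> subgroup (fun x => S (f x)).
Proof.
case=> S1 SM SV; split; first by rewrite multiplicative1.
- by move=> x y Sx Sy; rewrite gmulfM; apply: SM.
- by move=> x Sx; rewrite multiplicativeV; apply: SV.
Qed.

Lemma normal_subgroup_kernel f : normal_subgroup (fun x => f x = 1).
Proof.
split; first split.
- exact: multiplicative1.
- by move=> x y fx fy; rewrite gmulfM fx fy mulg1.
- by move=> x fx; rewrite multiplicativeV fx invg1.
- by move=> x y fx; rewrite conjgE !gmulfM fx mul1g -gmulfM mulVg multiplicative1.
Qed.

End Homomorphisms.

Lemma subgroup_generated (G : groupType) (A : set G) : subgroup (generated A).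
Proof.
split.
- by move=> S [[S1 _ _] _].
- move=> x y Ax Ay S SA.
  by have [_ SM _] := SA.1; exact: (SM _ _ (Ax S SA) (Ay S SA)).
- by move=> x Ax S SA; have [_ _ SV] := SA.1; exact: SV (Ax S SA).
Qed.

Lemma commg_in_commutator_subgroup (G : groupType) (x y : G) :
  commutator_subgroup G [~ x, y].
Proof. by move=> S [_]; apply; exists x, y. Qed.

(** * The universal property of free groups *)

Section FreeGroupExtension.
Context {I : choiceType} {G : groupType}.
Variable x : I -> G.

Definition letter_value (l : I * bool) : G := if l.2 then (x l.1)^-1 else x l.1.

Definition fg_extend (w : free_group I) : G :=
  \prod_(l <- fg_word w) letter_value l.

Lemma letter_value_inv l : letter_value (letter_inv l) = (letter_value l)^-1.
Proof. by case: l => i [] /=; rewrite /letter_value /= ?invgK. Qed.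

Lemma prod_push l (w : seq (I * bool)) :
  \prod_(l' <- push l w) letter_value l' =
  letter_value l * \prod_(l' <- w) letter_value l'.
Proof.
case: w => [|l' w] /=; first by rewrite big_seq1 big_nil mulg1.
by case: eqP => [->|_]; rewrite !big_cons // letter_value_inv mulVKg.
Qed.

(** Multiplying by a reduced word amounts to pushing letters one by one, and a
    push either prepends a letter or cancels it against its inverse. *)
Lemma fg_extendM : {morph fg_extend : v w / v * w}.
Proof.
move=> v w; rewrite /fg_extend [fg_word (v * w)]fg_mulE.
elim: (fg_word v) => [|l u IHu]; first by rewrite big_nil mul1g.
by rewrite [foldr _ _ _]/= prod_push IHu big_cons mulgA.
Qed.

HB.instance Definition _ := isMultiplicative.Build _ _ fg_extend fg_extendM.

Lemma fg_extend_gen i : fg_extend (fg_gen i) = x i.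
Proof. by rewrite /fg_extend /= big_seq1. Qed.

End FreeGroupExtension.

(** A free group is generated by its free generators: a nonempty reduced word is
    the product of its first letter and its tail, which is again reduced. *)
Lemma free_group_ind (I : choiceType) (S : set (free_group I)) :
  subgroup S -> (forall i, S (fg_gen i)) -> forall w, S w.
Proof.
case=> S1 SM SV Sgen [w rw].
elim: w rw => [|l w IHw] rlw; first by rewrite (_ : FreeGroup _ = 1) //; apply: val_inj.
have rw : reduced w by apply: path_sorted rlw.
have rl : reduced [:: l] by [].
rewrite (_ : FreeGroup rlw = FreeGroup rl * FreeGroup rw); last first.
  by apply: val_inj; rewrite [RHS]fg_mulE /= -[LHS](reduce_id rlw) /= reduce_id.
apply: SM (IHw rw).
case: l rl {rlw} => i [] rl.
  rewrite (_ : FreeGroup rl = (fg_gen i)^-1); first exact: SV.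
  exact: val_inj.
rewrite (_ : FreeGroup rl = fg_gen i); first exact: Sgen.
exact: val_inj.
Qed.

(** * Groups given by a presentation *)

Section Presentations.
Context {G : groupType} {I : choiceType}.
Variables (x : I -> G) (R : set (free_group I)).
Hypothesis presG : presented_by x R.

Lemma presented_by_ind (S : set G) :
  subgroup S -> (forall i, S (x i)) -> forall g, S g.
Proof.
move=> sgS Sx g; have [f [fx rf _]] := presG.
have [w _ <-] : range f g by rewrite rf.
apply: (@free_group_ind _ (fun w => S (f w)) (subgroup_preimage f sgS)) => i.
by rewrite fx.
Qed.

(** Von Dyck's theorem. The kernel of the extension of y to the free group is
    normal and contains R, so it contains the kernel of the canonical map onto
    G; a choice of preimages under that map then yields a homomorphism on G. *)
Lemma presented_by_extend (K : groupType) (y : I -> K) :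
    (forall r, R r -> fg_extend y r = 1) ->
  exists h : {multiplicative G -> K}, forall i, h (x i) = y i.
Proof.
move=> yR; have [f [fx rf kf]] := presG.
have lift g : {w | f w = g}.
  by apply: cid; have [w _ <-] : range f g by [rewrite rf]; exists w.
have fE v w : f v = f w -> fg_extend y v = fg_extend y w.
  move=> fvw; apply: divg1_eq; rewrite -multiplicativeV -gmulfM.
  have: (f @^-1` [set 1])%classic (v / w).
    by rewrite /= gmulfM fvw -gmulfM mulgV multiplicative1.
  rewrite kf => /(_ (fun u => fg_extend y u = 1)); apply; split => //.
  exact: normal_subgroup_kernel.
pose h g := fg_extend y (sval (lift g)).
have hf w : h (f w) = fg_extend y w.
  exact/fE/(svalP (lift (f w))).
have hM : {morph h : g1 g2 / g1 * g2}.
  move=> g1 g2; rewrite -[in LHS](svalP (lift g1)) -[in LHS](svalP (lift g2)).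
  by rewrite -gmulfM hf gmulfM.
pose hhom : {multiplicative G -> K} :=
  HB.pack h (isMultiplicative.Build _ _ h hM).
exists hhom => i.
by rewrite -fx [LHS]hf fg_extend_gen.
Qed.

Lemma presented_by_relator r : R r -> fg_extend x r = 1.
Proof.
move=> Rr; have [f [fx _ kf]] := presG.
have fE w : f w = fg_extend x w.
  apply: (@free_group_ind _ (fun w => f w = fg_extend x w)).
    split; first by rewrite !multiplicative1.
    - by move=> v u ev eu; rewrite !gmulfM ev eu.
    - by move=> v ev; rewrite !multiplicativeV ev.
  by move=> i; rewrite fx fg_extend_gen.
rewrite -fE; suff: (f @^-1` [set 1])%classic r by [].
by rewrite kf => S [_]; apply.
Qed.

End Presentations.

(** * Wreath products *)

HB.instance Definition _ (U V : finZmodType) := Finite.on (U * V)%type.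

Section Wreath.
Variables (A : finZmodType) (F : groupType).
Import GRing.Theory.

(** The pair (p, c) stands for the permutation (w, k) |-> (w c(k), k + p) of
    F x A, and products are composed from left to right. The type is kept
    apart from the plain pair type, which carries the direct product. *)
Definition wreath : Type := (A * {ffun A -> F})%type.

HB.instance Definition _ := Choice.on wreath.

Definition wreath_one : wreath := (0%R, [ffun=> 1]).
Definition wreath_mul (g h : wreath) : wreath :=
  ((g.1 + h.1)%R, [ffun k => g.2 k * h.2 (k + g.1)%R]).
Definition wreath_inv (g : wreath) : wreath :=
  ((- g.1)%R, [ffun k => (g.2 (k - g.1)%R)^-1]).

Lemma wreath_mulA : associative wreath_mul.
Proof.
move=> g h k; congr pair; first by rewrite /= addrA.
by apply/ffunP => i; rewrite !ffunE /= mulgA addrA.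
Qed.

Lemma wreath_mul1g : left_id wreath_one wreath_mul.
Proof.
case=> p c; congr pair; first by rewrite /= add0r.
by apply/ffunP => i; rewrite !ffunE /= mul1g addr0.
Qed.

Lemma wreath_mulg1 : right_id wreath_one wreath_mul.
Proof.
case=> p c; congr pair; first by rewrite /= addr0.
by apply/ffunP => i; rewrite !ffunE /= mulg1.
Qed.

Lemma wreath_mulVg : left_inverse wreath_one wreath_inv wreath_mul.
Proof.
move=> g; congr pair; first by rewrite /= addNr.
by apply/ffunP => i; rewrite !ffunE /= mulVg.
Qed.

Lemma wreath_mulgV : right_inverse wreath_one wreath_inv wreath_mul.
Proof.
move=> g; congr pair; first by rewrite /= subrr.
by apply/ffunP => i; rewrite !ffunE /= addrK mulgV.
Qed.

HB.instance Definition _ := isGroup.Build wreath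
  wreath_mulA wreath_mul1g wreath_mulg1 wreath_mulVg wreath_mulgV.

Lemma wreath_eq (g h : wreath) : g.1 = h.1 -> g.2 =1 h.2 -> g = h.
Proof. by case: g h => p c [q d] /= -> /ffunP ->. Qed.

Lemma wreathM1 (g h : wreath) : (g * h).1 = (g.1 + h.1)%R.
Proof. by []. Qed.

Lemma wreathM2 (g h : wreath) k : (g * h).2 k = g.2 k * h.2 (k + g.1)%R.
Proof. by rewrite ffunE. Qed.

Lemma wreath12 k : (1 : wreath).2 k = 1.
Proof. by rewrite ffunE. Qed.

Lemma wreathV1 (g : wreath) : g^-1.1 = (- g.1)%R.
Proof. by []. Qed.

Lemma wreathV2 (g : wreath) k : g^-1.2 k = (g.2 (k - g.1)%R)^-1.
Proof. by rewrite ffunE. Qed.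

Section SchreierRewriting.
Context {G : groupType}.
Variable h : {multiplicative G -> wreath}.

Lemma subgroup_wreath_base : subgroup (fun g => (h g).1 = 0%R).
Proof.
split; first by rewrite multiplicative1.
- by move=> g g' hg hg'; rewrite gmulfM wreathM1 hg hg' addr0.
- by move=> g hg; rewrite multiplicativeV wreathV1 hg oppr0.
Qed.

(** The A-component of h is a homomorphism to an abelian group. *)
Lemma wreath_base_commutator g :
  commutator_subgroup G g -> (h g).1 = 0%R.
Proof.
move=> /(_ (fun g => (h g).1 = 0%R)); apply; split.
  exact: subgroup_wreath_base.
move=> _ [g1 [g2 ->]]; rewrite commgEl conjgE !gmulfM !multiplicativeV.
rewrite !(wreathM1, wreathV1) addrCA addKr.
by rewrite addNr.
Qed.

(** The rewriting process of Schreier: if t lists coset representatives, the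
    equation says that moving g past t k costs the factor f (c k), where
    h g = (p, c), and leads to the representative t (k + p). The multiplication
    of the wreath product is what makes these costs compose, so the equation
    holds for all g once it holds for generators. *)
Lemma subgroup_schreier (f : {multiplicative F -> G}) (t : A -> G) :
  subgroup (fun g => forall k, t k * g = f ((h g).2 k) * t (k + (h g).1)%R).
Proof.
split.
- move=> k; rewrite multiplicative1 wreath12.
  by rewrite multiplicative1 addr0 mulg1 mul1g.
- move=> g g' tg tg' k.
  by rewrite gmulfM wreathM2 wreathM1 gmulfM mulgA tg -mulgA tg' mulgA addrA.
- move=> g tg k; rewrite multiplicativeV wreathV2 wreathV1.
  apply: (@mulIg _ g); apply: (@mulgI _ (f ((h g).2 (k - (h g).1)%R))).
  by rewrite mulgVK multiplicativeV mulgA mulVKg tg subrK.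
Qed.

(** On the elements with A-component 0, evaluating the second component at 0 is
    multiplicative. Hence whether this evaluation is a left inverse of f, which
    makes f injective, can be tested on generators. *)
Lemma subgroup_wreath_retract (f : {multiplicative F -> G}) :
  subgroup (fun w => (h (f w)).1 = 0%R /\ (h (f w)).2 0%R = w).
Proof.
split.
- by rewrite !multiplicative1 wreath12.
- move=> v w [v1 v2] [w1 w2].
  by rewrite !gmulfM wreathM1 wreathM2 v1 w1 v2 addr0 w2.
- move=> v [v1 v2].
  by rewrite !multiplicativeV wreathV1 wreathV2 v1 subr0 v2 oppr0.
Qed.

End SchreierRewriting.

End Wreath.

(** * The modular group *)

Section ModularGroup.

Local Notation F := (free_group 'I_2).
Local Notation A := ('Z_2 * 'Z_3)%type.

(** The letters for beta_0, beta_1 and beta_2 = beta_{-1}. The middle one is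
    forced by beta_0 beta_1 beta_2 = 1, which is the relation b^3 = 1 in the
    wreath product (wreath_b_order3). *)
Definition beta (j : 'Z_3) : F :=
  let x := fg_gen ord0 in let y := fg_gen ord_max in
  nth 1 [:: y; y^-1 * x^-1; x] j.

(** The values at (i, j) are the factors produced by moving a and b past
    b^j a^i. *)
Definition wreath_a : wreath A F := ((1, 0)%R, [ffun=> 1]).
Definition wreath_b : wreath A F :=
  ((0, 1)%R, [ffun k => if k.1 == 0%R then 1 else beta k.2]).

Lemma wreath_a_order2 : wreath_a ^+ 2 = 1.
Proof.
apply: wreath_eq => [|k]; first exact/eqP.
by rewrite expg2 wreathM2 wreath12 !ffunE mulg1.
Qed.

Lemma wreath_b_order3 : wreath_b ^+ 3 = 1.
Proof.
apply: wreath_eq => [|[i j]]; first exact/eqP.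
rewrite expgSS expg2 !wreathM2 wreath12 !ffunE /= !GRing.addr0.
case: eqP => _; first by rewrite !mulg1.
case: j => [[|[|[|]]] // lt_j3]; rewrite /beta /=.
- by rewrite mulgA mulgA mulgV mul1g mulVg.
- by rewrite -mulgA mulKg mulVg.
- by rewrite mulVKg mulgV.
Qed.

(** The value at 0 comes from the occurrence of b or b^-1 that acts while the
    Z/2-component is 1; the other occurrence contributes 1. *)
Lemma wreath_beta_minus1 (g := wreath_b^-1 * wreath_a * wreath_b * wreath_a^-1) :
  g.1 = 0%R /\ g.2 0%R = fg_gen ord0.
Proof.
split; first exact/eqP.
by rewrite /g !wreathM2 !wreathV2 !ffunE /= invg1 !mul1g mulg1.
Qed.

Lemma wreath_beta_0 (g := wreath_a * wreath_b * wreath_a^-1 * wreath_b^-1) :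
  g.1 = 0%R /\ g.2 0%R = fg_gen ord_max.
Proof.
split; first exact/eqP.
by rewrite /g !wreathM2 !wreathV2 !ffunE /= invg1 !mul1g !mulg1.
Qed.

Variables (G : groupType) (a b : G).
Hypotheses (a2 : a ^+ 2 = 1) (b3 : b ^+ 3 = 1).

Local Notation f := (fg_extend
  (tnth [tuple b^-1 * a * b * a^-1; a * b * a^-1 * b^-1])).

Definition coset_rep (k : A) : G := b ^+ k.2 * a ^+ k.1.

Lemma coset_rep_a k :
  coset_rep k * a = f (wreath_a.2 k) * coset_rep (k + wreath_a.1)%R.
Proof.
rewrite ffunE multiplicative1 mul1g /coset_rep -mulgA -expgSr.
case: k => i j; rewrite (_ : (_ + _)%R = (i + 1, j)%R); last first.
  by congr pair; rewrite GRing.addr0.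
by case: i => -[|[|]] // lt_i2; rewrite /= a2.
Qed.

(** For i = 0 nothing is produced; for i = 1 the equation is the definition of
    beta_0 and beta_{-1} when j = 0 and j = 2, and for j = 1 it expresses
    beta_1 = b a b a^-1 b^-2 as beta_0^-1 beta_{-1}^-1. *)
Lemma coset_rep_b k :
  coset_rep k * b = f (wreath_b.2 k) * coset_rep (k + wreath_b.1)%R.
Proof.
have b3E : b * b * b = 1 by rewrite -mulgA.
have bV : b^-1 = b * b by apply: mulg1_eq; rewrite mulgA.
rewrite ffunE /coset_rep; case: k => i j.
rewrite (_ : (_ + _)%R = (i, j + 1)%R); last first.
  by congr pair; rewrite GRing.addr0.
case: i => -[|[|]] // lt_i2; rewrite /=.
  rewrite multiplicative1 mul1g !mulg1 -expgSr.
  by case: j => [[|[|[|]]] // lt_j3].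
have ft1 : f (fg_gen ord0) = b^-1 * a * b * a^-1 by rewrite fg_extend_gen.
have ft2 : f (fg_gen ord_max) = a * b * a^-1 * b^-1 by rewrite fg_extend_gen.
case: j => [[|[|[|]]] // lt_j3]; rewrite /beta /= ?expg2.
- by rewrite ft2 mul1g !mulgA mulgVK mulgVK.
- rewrite gmulfM !multiplicativeV /= ft1 ft2 !invgM !invgK.
  by rewrite -bV !mulgA mulgVK mulgK mulgVK -(mulgA _ b^-1) -invgM -bV invgK.
- by rewrite ft1 mul1g mulgVK bV.
Qed.

End ModularGroup.

Theorem mainTheorem7 (G : groupType) (a b : G) :
  modular_presentation a b ->
  freely_generated_by (commutator_subgroup G)
    (tnth [tuple b^-1 * a * b * a^-1; a * b * a^-1 * b^-1]).
Proof.
move=> presG.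
have a2 : a ^+ 2 = 1.
  have := presented_by_relator presG (or_introl erefl).
  by rewrite expg2 gmulfM /= fg_extend_gen.
have b3 : b ^+ 3 = 1.
  have := presented_by_relator presG (or_intror erefl).
  by rewrite expgSS expg2 !gmulfM /= fg_extend_gen.
have [h hgen] : exists h : {multiplicative G -> wreath ('Z_2 * 'Z_3)%type _},
    forall i, h (tnth [tuple a; b] i) = tnth [tuple wreath_a; wreath_b] i.
  apply: (presented_by_extend presG) => _ [->|->].
    by rewrite expg2 gmulfM /= fg_extend_gen; apply: wreath_a_order2.
  by rewrite expgSS expg2 !gmulfM /= fg_extend_gen; apply: wreath_b_order3.
have ha : h a = wreath_a by exact: (hgen ord0).
have hb : h b = wreath_b by exact: (hgen ord_max).
set betas := tnth _.
have rewriting : forall g k,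
    coset_rep a b k * g =
    fg_extend betas ((h g).2 k) * coset_rep a b (k + (h g).1)%R.
  apply: (presented_by_ind presG (subgroup_schreier h _ _)) => i k.
  case: i => -[|[|]] // lt_i2; rewrite hgen !(tnth_nth 1) /=.
    exact: coset_rep_a.
  exact: coset_rep_b.
have retract : forall w : free_group 'I_2,
    (h (fg_extend betas w)).1 = 0%R /\ (h (fg_extend betas w)).2 0%R = w.
  apply: (free_group_ind (subgroup_wreath_retract h _)) => i.
  case: i => -[|[|]] // lt_i2; rewrite /= fg_extend_gen /betas (tnth_nth 1) /=.
    rewrite !gmulfM !multiplicativeV ha hb.
    rewrite wreath_beta_minus1.1 wreath_beta_minus1.2.
    by split=> //; congr fg_gen; apply: val_inj.
  rewrite !gmulfM !multiplicativeV ha hb wreath_beta_0.1 wreath_beta_0.2.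
  by split=> //; congr fg_gen; apply: val_inj.
exists (fg_extend betas); split.
- exact: fg_extend_gen.
- by move=> v w vw; rewrite -(proj2 (retract v)) vw (proj2 (retract w)).
apply/seteqP; split=> [_ [w _ <-]|g /(wreath_base_commutator h) hg].
  apply: (@free_group_ind _
    (fun w => commutator_subgroup G (fg_extend betas w))).
    exact: subgroup_preimage (subgroup_generated _).
  case=> -[|[|]] // lt_i2; rewrite fg_extend_gen /betas (tnth_nth 1) /=.
    have := commg_in_commutator_subgroup b a^-1.
    by rewrite commgEl conjgE invgK !mulgA.
  have := commg_in_commutator_subgroup a^-1 b^-1.
  by rewrite commgEl conjgE !invgK !mulgA.
have := rewriting g 0%R.
rewrite hg GRing.addr0 /coset_rep !mul1g mulg1 => ->.
by exists ((h g).2 0%R).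
Qed.
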